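(* Let $P$ be a poset and let $A\subset P^*$ be full and separating. Then $P$ is isomorphic, as a poset, to $\mathrm{C}_1\mathrm{O}_2(A,\mathbf{C}_{1,A},\mathbf{C}_{2,A})$ ordered by inclusion.
   Context: For a poset $P$, $P^*$ denotes the set of all isotone (order-preserving) maps from $P$ to $\mathbf 2=\{0,1\}$ with $0<1$. A closure on a set $M$ is a map $\mathbf C:\exp(M)\to\exp(M)$ on subsets of $M$ with $X\subset\mathbf C(X)$, $\mathbf C(\mathbf C(X))=\mathbf C(X)$, and $X\subset Y\Rightarrow\mathbf C(X)\subset\mathbf C(Y)$. A set $X$ is closed if $X=\mathbf C(X)$ and open if $M\setminus X$ is closed. For $\mathcal K\subset\exp(M)$, $\mathrm{clos}(\mathcal K)$ is the closure whose closed sets are exactly the intersections of subfamilies of $\mathcal K$ (the empty intersection being $M$). For two closures $\mathbf C_1,\mathbf C_2$ on $M$, $\mathrm{C}_1\mathrm{O}_2(M,\mathbf C_1,\mathbf C_2)$ is the collection of all subsets of $M$ that are both $\mathbf C_1$-closed and $\mathbf C_2$-open, ordered by inclusion. For $A\subset P^*$ and $p\in P$ put $\mathcal{UP}_A(p)=\{x\in A: x(p)=1\}$ and $\mathcal{LO}_A(p)=\{x\in A: x(p)=0\}$, and let $\mathbf C_{1,A}=\mathrm{clos}\{\mathcal{UP}_A(p)\}_{p\in P}$, $\mathbf C_{2,A}=\mathrm{clos}\{\mathcal{LO}_A(p)\}_{p\in P}$ be closures on $A$. An $A$-ideal (ideal with respect to $A$) is a subset of $P$ of the form $\bigcap_{x\in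 B}x^{-1}(0)$ with $B\subset A$; an $A$-filter is a subset of the form $\bigcap_{x\in B}x^{-1}(1)$ with $B\subset A$. Here $B=\emptyset$ is allowed and gives $P$. $A$ is full if for all $p,q\in P$ with $p\not\leq q$ there is $x\in A$ with $x(p)=1$, $x(q)=0$. $A$ is separating if for any disjoint $A$-ideal $I$ and $A$-filter $F$ there is $x\in A$ with $x|_I=0$ and $x|_F=1$. *)

(* Defs.v *)
From HB Require Import structures.
From mathcomp Require Import all_boot all_order.
From mathcomp Require Import boolp classical_sets.

Set Implicit Arguments.
Unset Strict Implicit.
Unset Printing Implicit Defensive.

Import Order.TTheory.
Local Open Scope classical_set_scope.

Record closure (M : Type) := Closure {
  closure_fun :> set M -> set M;
  closure_ext : forall X, X `<=` closure_fun X;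
  closure_idem : forall X, closure_fun (closure_fun X) = closure_fun X;
  closure_mono : forall X Y, X `<=` Y -> closure_fun X `<=` closure_fun Y
}.

Definition closed_set (M : Type) (C : closure M) (X : set M) : Prop :=
  X = C X.

Definition open_set (M : Type) (C : closure M) (X : set M) : Prop :=
  closed_set C (~` X).

Lemma smallest_idem (M : Type) (K : set (set M)) (X : set M) :
  smallest K (smallest K X) = smallest K X.
Proof.
apply/seteqP; split=> [x + Y [KY XY]|]; last exact: sub_gen_smallest.
by apply; split=> //; apply: smallest_sub.
Qed.

Lemma smallest_mono (M : Type) (K : set (set M)) (X Y : set M) :
  X `<=` Y -> smallest K X `<=` smallest K Y.
Proof. by move=> XY x Kx Z [KZ YZ]; apply: Kx; split=> // y /XY/YZ. Qed.

(* [smallest K X] is the intersection of all members of [K] that contain [X];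
   [K] is not assumed to be stable under intersection. *)
Definition clos (M : Type) (K : set (set M)) : closure M :=
  Closure (@sub_gen_smallest M K) (@smallest_idem M K) (@smallest_mono M K).

Lemma closed_closP (M : Type) (K : set (set M)) (X : set M) :
  closed_set (clos K) X <->
  exists2 F : set (set M), F `<=` K & X = \bigcap_(Y in F) Y.
Proof.
split=> [XE|[F FK XE]].
  by exists [set Y | K Y /\ X `<=` Y] => // Y [].
apply/seteqP; split; first exact: closure_ext.
move=> x Kx; rewrite XE => Y FY; apply: Kx; split; first exact: FK.
by rewrite XE => y; apply.
Qed.

Lemma closure_determined (M : Type) (C1 C2 : closure M) :
  (forall X, closed_set C1 X <-> closed_set C2 X) ->
  forall X, C1 X = C2 X.
Proof.
have sub (C D : closure M) X :
    (forall Y, closed_set D Y -> closed_set C Y) -> C X `<=` D X.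
  move=> DC; rewrite [in X in _ `<=` X](DC (D X)); last first.
    by rewrite /closed_set closure_idem.
  exact/closure_mono/closure_ext.
by move=> E X; apply/seteqP; split; apply: sub => Y /E.
Qed.

Definition C1O2_sets (M : Type) (C1 C2 : closure M) : set (set M) :=
  [set X | closed_set C1 X /\ open_set C2 X].

Definition C1O2 (M : Type) (C1 C2 : closure M) : Type :=
  {X : set M | X \in C1O2_sets C1 C2}.

HB.instance Definition _ (M : Type) (C1 C2 : closure M) :=
  SubChoice.on (C1O2 C1 C2).

(* The order induced from [set M], i.e. inclusion. *)
HB.instance Definition _ (M : Type) (C1 C2 : closure M) :=
  [SubChoice_isSubPOrder of C1O2 C1 C2 by <: with set_display].

Lemma C1O2_leE (M : Type) (C1 C2 : closure M) (X Y : C1O2 C1 C2) :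
  (X <= Y)%O <-> val X `<=` val Y.
Proof. by rewrite -Order.le_val subsetEset. Qed.

Definition poset_isomorphic (d1 d2 : Order.disp_t)
    (P : porderType d1) (Q : porderType d2) : Prop :=
  exists2 f : P -> Q, bijective f & {mono f : p q / (p <= q)%O}.

Section Dual.
Variables (d : Order.disp_t) (P : porderType d).

(* [bool] carries its canonical order [false < true]. *)
Definition isotone_dual : Type := {omorphism P -> bool}.

Variable A : set isotone_dual.

(* The subset [A] is used as a type, [{x | x \in A}], so that [set A] is the
   powerset of [A]; in particular complements are taken relative to [A]. *)
Definition UP (p : P) : set A := [set x : A | (val x : isotone_dual) p = true].
Definition LO (p : P) : set A := [set x : A | (val x : isotone_dual) p = false].

Definition closure1 : closure A := clos (range UP).
Definition closure2 : closure A := clos (range LO).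

Definition is_ideal (I : set P) : Prop :=
  exists2 B : set isotone_dual, B `<=` A &
    I = \bigcap_(x in B) [set p | x p = false].

Definition is_filter (F : set P) : Prop :=
  exists2 B : set isotone_dual, B `<=` A &
    F = \bigcap_(x in B) [set p | x p = true].

Definition full : Prop :=
  forall p q : P, ~~ (p <= q)%O ->
  exists2 x : isotone_dual, A x & x p = true /\ x q = false.

Definition separating : Prop :=
  forall I F : set P, is_ideal I -> is_filter F -> I `&` F = set0 ->
  exists2 x : isotone_dual, A x &
    (forall p, I p -> x p = false) /\ (forall p, F p -> x p = true).

End Dual.

Arguments UP {d P} A p _.
Arguments LO {d P} A p _.

(* Main.v *)
(* The isomorphism is p |-> UP A p.  It is an order embedding because A is full.
   For surjectivity, let X be closed-open, let F be the A-filter of all points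
   where every x in X equals 1 and I the A-ideal of all points where every x
   outside X equals 0.  An x in A separating I from F would lie both in X
   (X is an intersection of sets UP A p, with p in F) and outside X, so I and F
   share a point p, and then X = UP A p. *)
Require Import Defs.
From mathcomp Require Import all_boot all_order.
From mathcomp Require Import boolp classical_sets.

Import Order.TTheory.
Local Open Scope classical_set_scope.

Section Representation.
Variables (d : Order.disp_t) (P : porderType d) (A : set (isotone_dual P)).

Lemma setC_UP (p : P) : ~` UP A p = LO A p.
Proof.
by apply/seteqP; split=> x; rewrite /UP /LO /=; case: ((val x : isotone_dual P) p).
Qed.

(** [UP A p] is itself a generator of [closure1], and its complement in [A] is a generator of
    [closure2]. *)
Lemma UP_C1O2 (p : P) : C1O2_sets (closure1 A) (closure2 A) (UP A p).
Proof.
split; [|rewrite /open_set setC_UP]; apply/closed_closP.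
  by exists [set UP A p]; [move=> _ ->; exists p | rewrite bigcap_set1].
by exists [set LO A p]; [move=> _ ->; exists p | rewrite bigcap_set1].
Qed.

Lemma UP_subset (fullA : full A) (p q : P) : UP A p `<=` UP A q <-> (p <= q)%O.
Proof.
split=> [UPpq | le_pq x /= xp].
  apply: contrapT => /negP /fullA [x Ax [xp xq]].
  by have := UPpq (exist _ x (mem_set Ax)) xp; rewrite /UP /= xq.
have := omorph_le (val x : isotone_dual P) le_pq.
by rewrite /UP /= xp; case: ((val x : isotone_dual P) q).
Qed.

Lemma C1O2_UP (sepA : separating A) (X : set A) :
  C1O2_sets (closure1 A) (closure2 A) X -> exists p, X = UP A p.
Proof.
move=> [/closed_closP [U UA XU] /closed_closP [L LA XL]].
(* Filters and ideals are cut out by sets of isotone maps, so [X] and its complement relative to [A]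
   are pushed forward along [val]. *)
pose F := \bigcap_(x in val @` X) [set p | (x : isotone_dual P) p = true].
pose I := \bigcap_(x in val @` ~` X) [set p | (x : isotone_dual P) p = false].
have valA (Y : set A) : val @` Y `<=` A by move=> _ [x _ <-]; exact: set_mem (valP x).
have [p [Ip Fp]] : I `&` F !=set0.
  apply/set0P/eqP => IF0.
  have [||x Ax [xI xF]] := sepA I F _ _ IF0.
  - by exists (val @` ~` X).
  - by exists (val @` X).
  pose a : A := exist _ x (mem_set Ax).
  (* The complement of [X] is an intersection of sets [LO A p]; all its points vanish at each such
     [p], so [p] lies in [I] and [xI] applies. *)
  have : (~` X) a.
    rewrite XL => Y LY; have [p _ pY] := LA _ LY.
    rewrite -pY; apply: xI => _ [y Xy <-].
    by move: Xy; rewrite XL => /(_ _ LY); rewrite -pY.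
  apply; rewrite XU => Y UY; have [p _ pY] := UA _ UY.
  rewrite -pY; apply: xF => _ [y Xy <-].
  by move: Xy; rewrite XU => /(_ _ UY); rewrite -pY.
exists p; apply/seteqP; split=> [x Xx | x xp]; first by apply: Fp; exists x.
apply: contrapT => nXx.
have : (val x : isotone_dual P) p = false by apply: Ip; exists x.
by rewrite xp.
Qed.

End Representation.

Theorem corollary2p1 (d : Order.disp_t) (P : porderType d)
    (A : set (isotone_dual P)) :
  full A -> separating A ->
  poset_isomorphic P (C1O2 (closure1 A) (closure2 A)).
Proof.
move=> fullA sepA.
pose f (p : P) : C1O2 (closure1 A) (closure2 A) :=
  exist _ (UP A p) (mem_set (UP_C1O2 _ _ A p)).
have f_mono : {mono f : p q / (p <= q)%O}.
  move=> p q; apply/idP/idP.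
    by move=> /C1O2_leE /(UP_subset _ _ _ fullA).
  by move=> le_pq; apply/C1O2_leE/(UP_subset _ _ _ fullA).
have f_surj X : exists p, f p = X.
  have [p Xp] := C1O2_UP _ _ _ sepA (val X) (set_mem (valP X)).
  by exists p; apply: val_inj; rewrite Xp.
(* The chosen right inverse is two-sided, since an order embedding is injective. *)
have [g fg] := choice f_surj.
exists f => //; exists g => // p.
by apply: (inc_inj f_mono); rewrite fg.
Qed.
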